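(* Let $\mathcal{H}$ be a complex separable infinite-dimensional Hilbert space and let $T$ be a bounded linear operator on $\mathcal{H}$. (a) If $\gamma(T)>0$, there exists a linearly independent set of generators for $T$ of cardinality $\gamma(T)$. Moreover, if $0<\gamma(T)<+\infty$, every set of generators for $T$ with cardinality $\gamma(T)$ is linearly independent. (b) The same holds for the Parseval index: if $\gamma_p(T)>0$, there exists a linearly independent set of Parseval generators for $T$ of cardinality $\gamma_p(T)$, and if $0<\gamma_p(T)<+\infty$, every set of Parseval generators for $T$ with cardinality $\gamma_p(T)$ is linearly independent.
   Context: A countable family $\{x_k\}_k$ in $\mathcal{H}$ is a frame of $\mathcal{H}$ if there are $A,B>0$ with $A\|x\|^2\leqslant\sum_k|\langle x,x_k\rangle|^2\leqslant B\|x\|^2$ for all $x\in\mathcal{H}$, and a Parseval frame if one can take $A=B=1$. For $T$ bounded on $\mathcal{H}$, an at most countable collection (indexed family) of non-zero vectors $\{v_i\}_{i\in I}\subseteq\mathcal{H}$ is a set of generators (resp. Parseval generators) for $T$ if $\{T^nv_i\}_{i\in I,n\geqslant0}$ is a frame (resp. Parseval frame) of $\mathcal{H}$. The frame index $\gamma(T)$ is the minimal $d\in\mathbb{N}$ such that there is a set of $d$ generators for $T$, if a finite set of generators exists; $\gamma(T)=0$ if $T$ has no set of generators; $\gamma(T)=+\infty$ if $T$ has a set of generators but no finite one. The Parseval frame index $\gamma_p(T)$ is defined in the same way with Parseval generators. Cardinality $+\infty$ means countably infinite. *)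

(* Defs.v *)
From HB Require Import structures.
From mathcomp Require Import all_boot all_order all_algebra.
From mathcomp Require Import all_classical all_reals all_analysis.
From mathcomp Require Import sesquilinear complex.
Set Implicit Arguments.
Unset Strict Implicit.
Unset Printing Implicit Defensive.
Import Order.TTheory GRing.Theory Num.Theory.
Import numFieldNormedType.Exports.
Local Open Scope classical_set_scope.
Local Open Scope ring_scope.
Local Open Scope complex_scope.

(* In a normed module over the complex numbers R[i], the norm of the library is
   itself an element of R[i] (a nonnegative real one).  This is its square as
   an element of R; for H := R[i] it is the squared modulus. *)
Definition sqnorm (R : realType) (H : normedModType R[i]) (x : H) : R :=
  complex.Re (`|x| ^+ 2).

Definition separable_space (H : topologicalType) : Prop :=
  exists2 D : set H, countable D & dense D.

Definition infinite_dimensional (R : realType) (H : lmodType R[i]) : Prop :=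
  ~ exists (n : nat) (e : 'I_n -> H),
      forall x : H, exists c : 'I_n -> R[i], x = \sum_(k < n) c k *: e k.

Definition bounded_operator (R : realType) (H : normedModType R[i])
    (T : H -> H) : Prop :=
  exists M : R, forall x : H, `|T x| <= M%:C * `|x|.

(* Linear independence of the family v, so no vector may be repeated. *)
Definition lin_independent (R : realType) (H : lmodType R[i]) (I : choiceType)
    (v : I -> H) : Prop :=
  forall (s : seq I) (c : I -> R[i]), uniq s ->
    \sum_(k <- s) c k *: v k = 0 -> forall k, k \in s -> c k = 0.

Section Generators.
Variables (R : realType) (H : normedModType R[i]) (dot : H -> H -> R[i]).

Definition frame_bounds (K : countType) (x : K -> H) (A B : R) : Prop :=
  forall y : H,
    ((A * sqnorm y)%:E
       <= \esum_(k in [set: K]) (sqnorm (dot y (x k) : R[i]^o))%:E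
       <= (B * sqnorm y)%:E)%E.

Definition is_frame (K : countType) (x : K -> H) : Prop :=
  exists A B : R, [/\ 0 < A, 0 < B & frame_bounds x A B].

Definition is_parseval_frame (K : countType) (x : K -> H) : Prop :=
  frame_bounds x 1 1.

Definition orbit_family (T : H -> H) (I : countType) (v : I -> H)
    (k : I * nat) : H := iter k.2 T (v k.1).

Definition generators (T : H -> H) (I : countType) (v : I -> H) : Prop :=
  (forall k, v k != 0) /\ is_frame (orbit_family T v).

Definition parseval_generators (T : H -> H) (I : countType) (v : I -> H) :
    Prop :=
  (forall k, v k != 0) /\ is_parseval_frame (orbit_family T v).

End Generators.

(* [has_cardinality I d]: I has cardinality d, for d a natural number (embedded
   in the extended integers, which provide the order) or +oo, the latter meaning
   countably infinite. *)
Definition has_cardinality (I : Type) (d : \bar int) : Prop :=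
  match d with
  | (Posz n)%:E => ([set: I] #= `I_n)%card
  | +oo => ([set: I] #= [set: nat])%card
  | _ => False
  end%E.

(* [G I v] stands for "v is a set of generators", of either kind. *)
Definition generator_index (H : Type)
    (G : forall I : countType, (I -> H) -> Prop) : \bar int :=
  if pselect (exists d : nat, `[< exists (I : countType) (v : I -> H),
                has_cardinality I d%:Z%:E /\ G I v >]) is left ex_finite
  then (ex_minn ex_finite)%:Z%:E
  else if `[< exists (I : countType) (v : I -> H), G I v >] then +oo%E
  else 0%E.

Definition frame_index (R : realType) (H : normedModType R[i])
    (dot : H -> H -> R[i]) (T : H -> H) : \bar int :=
  generator_index (@generators R H dot T).

Definition parseval_frame_index (R : realType) (H : normedModType R[i])
    (dot : H -> H -> R[i]) (T : H -> H) : \bar int :=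
  generator_index (@parseval_generators R H dot T).

(* Main.v *)
Require Import Defs.
From HB Require Import structures.
From mathcomp Require Import all_boot all_order all_algebra.
From mathcomp Require Import all_classical all_reals all_analysis.
From mathcomp Require Import sesquilinear complex.
From mathcomp Require Import ring lra.
Set Implicit Arguments.
Unset Strict Implicit.
Unset Printing Implicit Defensive.
Import Order.TTheory GRing.Theory Num.Theory.
Import numFieldNormedType.Exports.
Local Open Scope classical_set_scope.
Local Open Scope ring_scope.
Local Open Scope complex_scope.

(** Write [P = \sum_i <., v_i> v_i] for the frame operator of a family [v]; it is
a bounded positive operator as soon as [v] is a Bessel family.  The sums
[\sum_(i, n) |<y, T^n v_i>|^2 = \sum_n <P T*^n y, T*^n y>] that define frames of
orbits see [v] only through the quadratic form [<P x, x> = \sum_i |<x, v_i>|^2],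
which is called the energy of [v] below.  Two families of non-zero vectors with
the same energy are thus generators, or Parseval generators, simultaneously.

It is therefore enough to replace [v] by a linearly independent family with the
same energy.  Orthonormalise a dense sequence of H for the degenerate inner
product [q x y = <x, P y>], sending to 0 the vectors that become [q]-null; this
gives a sequence [h].  Put [w_k = P h_k].  Then [<h_j, w_k> = q h_j h_k] is a
Kronecker symbol on the indices with [w_j <> 0], so these vectors [w_j] are
linearly independent, and [\sum_k |<x, w_k>|^2 = \sum_k |q x h_k|^2 = q x x] by
the Parseval identity for [q] ([biorthogonal_tight_family],
[biorthogonal_family]).

If the index is infinite, [w] cannot be finite, which gives a countably infinite
independent set of generators.  If the index is [n > 0] and [v] is a set of [n]
generators, then [w] has at least [n] members by minimality.  The square matrix
of the [<h_j, v_i>], for [n] of the indices [j], is invertible: a vector in its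
left kernel gives a combination of the [h_j] orthogonal to all [v_i], thus of
energy 0, thus orthogonal to all [w_j], and biorthogonality makes its
coefficients vanish.  A linear relation between the [v_i] would be, up to
conjugation, in the right kernel of this matrix
([biorthogonal_card_lin_independent]).

The adjoint of [T], needed to write the orbit sums through energies, comes from
the Riesz representation theorem, which is obtained from the same Gram-Schmidt
process applied to the inner product itself ([Riesz_representation]). *)

(** * Gram-Schmidt for positive semidefinite forms *)

Section GramSchmidt.
Local Close Scope complex_scope.
Variables (C : numClosedFieldType) (V : lmodType C) (q : V -> V -> C).
Hypothesis qP : forall a x y z, q (a *: x + y) z = a * q x z + q y z.
Hypothesis qC : forall x y, q x y = (q y x)^*.
Hypothesis q_ge0 : forall x, 0 <= q x x.
Variable u : nat -> V.

(** As [0^-1 = 0], null vectors are normalized to 0, so that the process below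
needs no case distinction when the form is degenerate. *)
Definition normalize (x : V) : V := (sqrtC (q x x))^-1 *: x.

(** The component of [x] that is orthogonal to the first [n] vectors produced from
[u]; the recursion and the Gram-Schmidt vectors are mutually dependent. *)
Fixpoint residual (n : nat) (x : V) : V :=
  if n is m.+1 then
    let h := normalize (residual m (u m)) in
    residual m x - q (residual m x) h *: h
  else x.

Definition gram_schmidt (n : nat) : V := normalize (residual n (u n)).

Local Notation h := gram_schmidt.

Lemma residualS n x :
  residual n.+1 x = residual n x - q (residual n x) (h n) *: h n.
Proof. by []. Qed.

Lemma form_lin0 z : q 0 z = 0.
Proof. by have := qP (-1) 0 0 z; rewrite scaler0 addr0 mulN1r addNr. Qed.

Lemma form_linD x y z : q (x + y) z = q x z + q y z.
Proof. by rewrite -{1}[x]scale1r qP mul1r. Qed.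

Lemma form_linZ a x z : q (a *: x) z = a * q x z.
Proof. by rewrite -[a *: x]addr0 qP form_lin0 addr0. Qed.

Lemma form_linB x y z : q (x - y) z = q x z - q y z.
Proof. by rewrite form_linD -scaleN1r form_linZ mulN1r. Qed.

Lemma form_antiZ a x z : q z (a *: x) = a^* * q z x.
Proof. by rewrite qC form_linZ rmorphM /= -qC. Qed.

Lemma form_anti0 z : q z 0 = 0.
Proof. by rewrite qC form_lin0 rmorph0. Qed.

Lemma form_antiB x y z : q z (x - y) = q z x - q z y.
Proof. by rewrite qC form_linB rmorphB /= -!qC. Qed.

Lemma form_antiD x y z : q z (x + y) = q z x + q z y.
Proof. by rewrite qC form_linD rmorphD /= -!qC. Qed.

Lemma form_normalize x : q x x != 0 -> q (normalize x) (normalize x) = 1.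
Proof.
move=> x0; rewrite /normalize form_linZ form_antiZ.
rewrite mulrA -normCK normfV ger0_norm ?sqrtC_ge0 // exprVn sqrtCK.
by rewrite mulVf.
Qed.

Lemma normalize_null x : q x x = 0 -> normalize x = 0.
Proof. by move=> x0; rewrite /normalize x0 sqrtC0 invr0 scale0r. Qed.

Lemma gram_schmidt_unit n : h n = 0 \/ q (h n) (h n) = 1.
Proof.
have [/eqP x0|x0] := boolP (q (residual n (u n)) (residual n (u n)) == 0).
  by left; rewrite /h normalize_null.
by right; rewrite /h form_normalize.
Qed.

Lemma residual_orth n x k : (k < n)%N -> q (residual n x) (h k) = 0.
Proof.
elim: n x => [//|n IHn] x; rewrite ltnS leq_eqVlt => /predU1P[->|kn].
  rewrite residualS form_linB form_linZ.
  by have [->|->] := gram_schmidt_unit n; 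
    rewrite ?mulr1 ?subrr // !form_anti0 mulr0 subrr.
by rewrite residualS form_linB !form_linZ !IHn // !mulr0 subrr.
Qed.

Lemma gram_schmidt_orth j k : j != k -> q (h j) (h k) = 0.
Proof.
rewrite neq_ltn => /orP[] ljk; [rewrite qC|];
by rewrite form_linZ residual_orth // mulr0 ?rmorph0.
Qed.

Lemma form_residual_gram_schmidt n x : q (residual n x) (h n) = q x (h n).
Proof.
have: forall m, (m <= n)%N -> q (residual m x) (h n) = q x (h n).
  elim=> [//|m IHm] lmn; rewrite residualS form_linB form_linZ.
  rewrite IHm ?(ltnW lmn) //.
  by rewrite gram_schmidt_orth ?mulr0 ?subr0 // ltn_eqF.
exact.
Qed.

Lemma residualE n x :
  residual n x = x - \sum_(0 <= k < n) q x (h k) *: h k.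
Proof.
elim: n => [|n IHn]; first by rewrite big_geq // subr0.
rewrite residualS big_nat_recr //= form_residual_gram_schmidt IHn.
by rewrite opprD addrA.
Qed.

Lemma form_residual n x :
  q (residual n x) (residual n x) =
  q x x - \sum_(0 <= k < n) `|q x (h k)| ^+ 2.
Proof.
elim: n => [|n IHn]; first by rewrite big_geq // subr0.
rewrite residualS big_nat_recr //= opprD addrA -IHn.
rewrite -(form_residual_gram_schmidt n x).
have := gram_schmidt_unit n; move: (h n) (residual n x) => g r g_unit.
rewrite form_linB !form_antiB !form_linZ !form_antiZ [q g r]qC normCK.
by case: g_unit => ->; rewrite ?form_anti0; ring.
Qed.

Lemma residual_linB n x y : residual n (x - y) = residual n x - residual n y.
Proof.
elim: n => [//|n IHn]; rewrite !residualS IHn form_linB scalerBl.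
by rewrite !opprD !opprK addrACA.
Qed.

Lemma form_residual_le n x : q (residual n x) (residual n x) <= q x x.
Proof. by rewrite form_residual lerBlDr lerDl sumr_ge0. Qed.

(** After step [k] the residual of [u k] is 0, except when it was already null, in
which case it stays null because residuals only get smaller. *)
Lemma form_residual_null k n : (k < n)%N ->
  q (residual n (u k)) (residual n (u k)) = 0.
Proof.
elim: n => [//|n IHn]; rewrite ltnS leq_eqVlt => /predU1P[->|kn]; last first.
  apply/eqP; rewrite eq_le q_ge0 andbT -(IHn kn) !form_residual.
  by rewrite lerD2l lerN2 big_nat_recr //= lerDl.
rewrite residualS; set r := residual n (u n).
have [r0|r0] := eqVneq (q r r) 0.
  by rewrite /h normalize_null // scaler0 subr0.
suff -> : r - q r (h n) *: h n = 0 by rewrite form_lin0.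
rewrite /h form_antiZ scalerA -/r fmorphV /= geC0_conj ?sqrtC_ge0 //.
by rewrite mulrAC -expr2 exprVn sqrtCK mulVf // scale1r subrr.
Qed.

Lemma form_parallelogram_le x y :
  q (x + y) (x + y) <= 2 * q x x + 2 * q y y.
Proof.
rewrite -subr_ge0.
suff -> : 2 * q x x + 2 * q y y - q (x + y) (x + y) = q (x - y) (x - y).
  exact: q_ge0.
by rewrite !form_linB !form_antiB !form_linD !form_antiD; ring.
Qed.

(** The factor 2 is harmless in limits, and lets the parallelogram law stand in
for a Cauchy-Schwarz inequality with a null vector. *)
Lemma form_residual_approx k n x : (k < n)%N ->
  q (residual n x) (residual n x) <= 2 * q (x - u k) (x - u k).
Proof.
move=> kn; have -> : residual n x = residual n (x - u k) + residual n (u k).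
  by rewrite residual_linB subrK.
apply: le_trans (form_parallelogram_le _ _) _.
by rewrite form_residual_null // mulr0 addr0 ler_pM2l // form_residual_le.
Qed.
(** Bessel's inequality for the single vector [normalize y]. *)
Lemma form_CauchySchwarz x y : q y y != 0 ->
  `|q x y| ^+ 2 <= q x x * q y y.
Proof.
move=> y0; have y_gt0 : 0 < q y y by rewrite lt_def y0 q_ge0.
suff: `|q x (normalize y)| ^+ 2 <= q x x.
  rewrite /normalize form_antiZ normrM exprMn norm_conjC normfV.
  rewrite (ger0_norm (_ : 0 <= sqrtC _)) ?sqrtC_ge0 //.
  by rewrite exprVn sqrtCK mulrC ler_pdivrMr.
move: (normalize y) (form_normalize y0) => g g1.
rewrite -subr_ge0; have := q_ge0 (x - q x g *: g).
rewrite form_linB !form_antiB !form_linZ !form_antiZ [q g x]qC g1 normCK.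
by congr (0 <= _); ring.
Qed.

End GramSchmidt.

(** * Real-valued squared norms *)

Section SquaredModulus.
Variable R : realType.
Implicit Types z w : R[i].

(** The squared modulus without the detour through a norm with values in the
complex numbers. *)
Definition sqmod z : R := complex.Re z ^+ 2 + complex.Im z ^+ 2.

Lemma sqmodE z : (sqmod z)%:C = `|z| ^+ 2.
Proof. exact: add_Re2_Im2. Qed.

Lemma sqmod_ge0 z : 0 <= sqmod z.
Proof. by rewrite addr_ge0 ?sqr_ge0. Qed.

Lemma sqmod_sqnorm z : sqnorm (z : R[i]^o) = sqmod z.
Proof. by rewrite /sqnorm -[`|_| ^+ 2]sqmodE. Qed.

Lemma sqmod0 : sqmod 0 = 0.
Proof. by rewrite /sqmod /= expr0n addr0. Qed.

Lemma sqmod_eq0 z : (sqmod z == 0) = (z == 0).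
Proof. by rewrite -(inj_eq (@complexI R)) sqmodE expf_eq0 normr_eq0. Qed.

Lemma sqmod_conj z : sqmod (z^*)%R = sqmod z.
Proof. by apply: complexI; rewrite !sqmodE norm_conjC. Qed.

Lemma mulrJ_sqmod z : z * (z^*)%R = (sqmod z)%:C.
Proof. by rewrite sqmodE -normCK. Qed.

Lemma gt0_complex z : 0 < z -> exists2 r : R, 0 < r & z = r%:C.
Proof.
move=> z0; have zE : (complex.Re z)%:C = z by rewrite RRe_real // gtr0_real.
by exists (complex.Re z); rewrite // -ltcR zE.
Qed.

End SquaredModulus.

Section SquaredNorm.
Variables (R : realType) (H : normedModType R[i]).
Implicit Types x y : H.

Lemma sqnormE x : (sqnorm x)%:C = `|x| ^+ 2.
Proof. by rewrite /sqnorm RRe_real // realX // normr_real. Qed.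

Lemma sqnorm_ge0 x : 0 <= sqnorm x.
Proof. by rewrite -ler0c sqnormE exprn_ge0. Qed.

Lemma norm_lt_sqnorm x (e : R) : 0 < e -> (`|x| < e%:C) = (sqnorm x < e ^+ 2).
Proof.
move=> e0; rewrite -(@ltr_pXn2r _ 2) ?nnegrE ?ler0c ?(ltW e0) //.
by rewrite -sqnormE -rmorphXn /= ltcR.
Qed.

Lemma sqnorm_eq0 x : (sqnorm x == 0) = (x == 0).
Proof. by rewrite -(inj_eq (@complexI R)) sqnormE expf_eq0 normr_eq0. Qed.

End SquaredNorm.

(** * The inner product and its continuity *)

Section DotProduct.
Variables (R : realType) (H : normedModType R[i]) (dot : {dot H for Num.conj}).
Hypothesis dot_norm : forall x : H, `|x| ^+ 2 = dot x x.

Lemma dotP a x y z : dot (a *: x + y) z = a * dot x z + dot y z.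
Proof. exact: (linearPl dot). Qed.

Lemma dotC x y : dot x y = (dot y x)^*%R.
Proof. by rewrite (hermC dot) expr0 mul1r. Qed.

Lemma dot0r z : dot z 0 = 0.
Proof. exact: linear0r. Qed.

Lemma dotBl x y z : dot (x - y) z = dot x z - dot y z.
Proof. exact: linearBl. Qed.

Lemma dotBr x y z : dot z (x - y) = dot z x - dot z y.
Proof. exact: linearBr. Qed.

Lemma dotZl a x z : dot (a *: x) z = a * dot x z.
Proof. exact: (linearZl_LR dot). Qed.

Lemma dotZr a x z : dot z (a *: x) = (a^*)%R * dot z x.
Proof. exact: (linearZr_LR dot). Qed.

Lemma dot_suml I (r : seq I) (P : pred I) (F : I -> H) z :
  dot (\sum_(i <- r | P i) F i) z = \sum_(i <- r | P i) dot (F i) z.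
Proof. exact: linear_sumlz. Qed.

Lemma dot_sumr I (r : seq I) (P : pred I) (F : I -> H) z :
  dot z (\sum_(i <- r | P i) F i) = \sum_(i <- r | P i) dot z (F i).
Proof. exact: linear_sumr. Qed.

Lemma dot_ge0 x : 0 <= dot x x.
Proof. by rewrite -dot_norm exprn_ge0. Qed.

Lemma dot_sqnorm x : dot x x = (sqnorm x)%:C.
Proof. by rewrite sqnormE dot_norm. Qed.

Lemma dot_CauchySchwarz x y :
  sqmod (dot x y) <= sqnorm x * sqnorm y.
Proof.
have [->|y0] := eqVneq y 0.
  by rewrite dot0r sqmod0 mulr_ge0 ?sqnorm_ge0.
rewrite -lecR rmorphM /= -!dot_sqnorm sqmodE.
apply: (form_CauchySchwarz dotP dotC dot_ge0).
by rewrite dot_sqnorm (inj_eq (@complexI R)) sqnorm_eq0.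
Qed.

Lemma dot_normM x y : `|dot x y| <= `|x| * `|y|.
Proof.
rewrite -(@ler_pXn2r _ 2) ?nnegrE ?mulr_ge0 //.
rewrite exprMn -!sqnormE -sqmodE -rmorphM /= lecR.
exact: dot_CauchySchwarz.
Qed.

Lemma cvg_dotl (f : nat -> H) (l y : H) :
  f n @[n --> \oo] --> l ->
  (dot (f n) y : R[i]^o) @[n --> \oo] --> (dot l y : R[i]^o).
Proof.
move=> fl; apply/cvgrPdist_lt => e e0.
have y1 : 0 < `|y| + 1 by rewrite ltr_wpDl.
move/cvgrPdist_lt: fl => /(_ _ (divr_gt0 e0 y1)); apply: filterS => n lt_n.
rewrite -dotBl; apply: le_lt_trans (dot_normM _ _) _.
move: lt_n; rewrite ltr_pdivlMr //; apply: le_lt_trans.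
by rewrite ler_wpM2l // lerDl.
Qed.

Lemma cvg_dotr (f : nat -> H) (l y : H) :
  f n @[n --> \oo] --> l ->
  (dot y (f n) : R[i]^o) @[n --> \oo] --> (dot y l : R[i]^o).
Proof.
move=> /(@cvg_dotl _ _ y)/cvgrPdist_lt fl; apply/cvgrPdist_lt => e /fl.
by apply: filterS => n; rewrite -dotBl -dotBr [dot y _]dotC norm_conjC.
Qed.

End DotProduct.

(** * Bessel sequences and synthesis *)

Lemma ReD (R : realType) (z w : R[i]) :
  complex.Re (z + w) = complex.Re z + complex.Re w.
Proof. by case: z w => [a b] [c d]. Qed.

Lemma Re_sum (R : realType) I (r : seq I) (P : pred I) (F : I -> R[i]) :
  complex.Re (\sum_(i <- r | P i) F i) = \sum_(i <- r | P i) complex.Re (F i).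
Proof. by apply: (big_morph (@complex.Re R)) => // z w; exact: ReD. Qed.

(** The AM-GM inequality with a weight [B]; it replaces the Cauchy-Schwarz
inequality for finite sums in [bessel_synthesis_le]. *)
Lemma Re_mul_le (R : realType) (B : R) (z w : R[i]) :
  2 * B * complex.Re (z * w) <= B ^+ 2 * sqmod z + sqmod w.
Proof.
case: z w => [a b] [c d]; rewrite /sqmod /= -subr_ge0.
have -> : B ^+ 2 * (a ^+ 2 + b ^+ 2) + (c ^+ 2 + d ^+ 2)
    - 2 * B * (a * c - b * d) = (B * a - c) ^+ 2 + (B * b + d) ^+ 2 by ring.
by rewrite addr_ge0 ?sqr_ge0.
Qed.

Lemma normc_real (R : realType) (r : R) : `|r%:C| = `|r|%:C.
Proof. by rewrite normc_def /= expr0n addr0 sqrtr_sqr. Qed.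

Lemma cvg_real_complex (R : realType) (f : nat -> R) (l : R) :
  f n @[n --> \oo] --> l ->
  ((f n)%:C : R[i]^o) @[n --> \oo] --> (l%:C : R[i]^o).
Proof.
move=> /cvgrPdist_lt fl; apply/cvgrPdist_lt => e /gt0_complex[r r0 ->].
move: (fl r r0); apply: filterS => n.
by rewrite -rmorphB /= normc_real ltcR.
Qed.

Lemma cvg_complex_unique (R : realType) (f : nat -> R[i]) (a b : R[i]) :
  (f n : R[i]^o) @[n --> \oo] --> (a : R[i]^o) ->
  (f n : R[i]^o) @[n --> \oo] --> (b : R[i]^o) -> a = b.
Proof. exact: (@norm_cvg_unique _ R[i]^o). Qed.

Lemma sum_sqmod (R : realType) (f : nat -> R[i]) n :
  \sum_(0 <= k < n) `|f k| ^+ 2 = (\sum_(0 <= k < n) sqmod (f k))%:C.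
Proof. by rewrite rmorph_sum; apply: eq_bigr => k _; rewrite /= sqmodE. Qed.

Section BesselSequences.
Variables (R : realType) (H : completeNormedModType R[i]).
Variable dot : {dot H for Num.conj}.
Hypothesis dot_norm : forall x : H, `|x| ^+ 2 = dot x x.

Definition bessel (v : nat -> H) (B : R) : Prop :=
  forall n x, \sum_(0 <= k < n) sqmod (dot x (v k)) <= B * sqnorm x.

(** The synthesis operator is the adjoint of the analysis operator and has the
same norm.  With [s] the sum, expand [|s|^2 = \sum a_k <v_k, s>], apply
[Re_mul_le] to each term, and bound [\sum |<v_k, s>|^2] by [B * |s|^2]. *)
Lemma bessel_synthesis_le v B a m n : 0 < B -> bessel v B ->
  sqnorm (\sum_(m <= k < n) a k *: v k) <= B * \sum_(m <= k < n) sqmod (a k).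
Proof.
move=> B0 vB; have [lmn|lnm] := leqP m n; last first.
  rewrite !big_geq ?(ltnW lnm) // mulr0 le_eqVlt.
  by apply/orP; left; rewrite sqnorm_eq0.
set s := \sum_(m <= k < n) _.
have sE : sqnorm s = \sum_(m <= k < n) complex.Re (a k * dot (v k) s).
  have -> : sqnorm s = complex.Re (dot s s) by rewrite (dot_sqnorm dot_norm).
  rewrite {1}/s dot_suml Re_sum.
  by apply: eq_bigr => k _; rewrite dotZl.
have le_s : \sum_(m <= k < n) sqmod (dot (v k) s) <= B * sqnorm s.
  apply: le_trans (vB n s); rewrite (@big_cat_nat _ _ _ m 0 n) //=.
  rewrite ler_wpDl ?sumr_ge0 // => [k _|]; first exact: sqmod_ge0.
  by apply: ler_sum => k _; rewrite dotC sqmod_conj.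
have : 2 * B * sqnorm s <=
    B ^+ 2 * \sum_(m <= k < n) sqmod (a k) + B * sqnorm s.
  rewrite {1}sE mulr_sumr; apply: le_trans (lerD (lexx _) le_s).
  by rewrite mulr_sumr -big_split /=; apply: ler_sum => k _; exact: Re_mul_le.
by move: (sqnorm s) (\sum_(m <= k < n) _) => x y; nra.
Qed.

Lemma bessel_series_cvg v B (a : nat -> R[i]) M : 0 < B -> bessel v B ->
  (forall n, \sum_(0 <= k < n) sqmod (a k) <= M) ->
  cvgn (series (fun k => a k *: v k)).
Proof.
move=> B0 vB aM; apply/cauchy_cvgP/cauchy_seriesP => e /gt0_complex[r r0 ->].
have: cauchy (series (fun k => sqmod (a k)) @ \oo).
  apply/cauchy_cvgP; apply: nondecreasing_is_cvgn.
    by apply: nondecreasing_series => k _ _; exact: sqmod_ge0.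
  by exists M => _ [n _ <-]; exact: aM.
move/cauchy_seriesP => /(_ (r ^+ 2 / B)) [|[A1 A2] /= [A1oo A2oo] subA].
  by rewrite divr_gt0 ?exprn_gt0.
exists (A1, A2) => // -[m n] mn; have /= lt_mn := subA _ mn.
rewrite /= norm_lt_sqnorm //.
apply: le_lt_trans (bessel_synthesis_le _ _ _ B0 vB) _.
rewrite mulrC -ltr_pdivlMr //; apply: le_lt_trans lt_mn; exact: ler_norm.
Qed.

Section Totality.
Variables (q : H -> H -> R[i]) (B : R).
Hypothesis qP : forall a x y z, q (a *: x + y) z = a * q x z + q y z.
Hypothesis qC : forall x y, q x y = ((q y x)^*)%R.
Hypothesis q_ge0 : forall x, 0 <= q x x.
Hypothesis B_gt0 : 0 < B.
Hypothesis q_le : forall x, q x x <= (B * sqnorm x)%:C.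
Variable u : nat -> H.
Hypothesis u_dense : forall (x : H) e, 0 < e -> exists k, sqnorm (x - u k) < e.

(** Residuals are contractions that kill, up to null vectors, the terms [u k] of
the dense sequence already processed. *)
Lemma form_residual_near0 x (e : R) : 0 < e ->
  \forall n \near \oo, q (residual q u n x) (residual q u n x) < e%:C.
Proof.
move=> e0; have [|k ltk] := u_dense x (e := e / (2 * B)).
  by rewrite divr_gt0 // mulr_gt0.
near=> n; have kn : (k < n)%N by near: n; exact: nbhs_infty_gt.
apply: le_lt_trans (form_residual_approx qP qC q_ge0 u x kn) _.
have : 2 * q (x - u k) (x - u k) <= (2 * (B * sqnorm (x - u k)))%:C.
  by rewrite rmorphM rmorph_nat ler_pM2l.
move/le_lt_trans; apply; rewrite ltcR mulrA mulrC -ltr_pdivlMr ?mulr_gt0 //.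
Unshelve. all: by end_near. Qed.

(** Parseval's identity for a possibly degenerate form. *)
Lemma cvg_sum_form_gram_schmidt x :
  \sum_(0 <= k < n) sqmod (q x (gram_schmidt q u k)) @[n --> \oo]
    --> complex.Re (q x x).
Proof.
apply/cvgrPdist_lt => e /(form_residual_near0 x).
apply: filterS => n; rewrite (form_residual qP qC q_ge0).
rewrite (sum_sqmod (fun k => q x (gram_schmidt q u k))).
have := q_ge0 (residual q u n x); rewrite (form_residual qP qC q_ge0).
rewrite (sum_sqmod (fun k => q x (gram_schmidt q u k))).
rewrite -[q x x]RRe_real ?ger0_real // -rmorphB /= ler0c ltcR => ? ?.
by rewrite ger0_norm.
Qed.

End Totality.
End BesselSequences.

(** * Riesz representation *)

Section Hilbert.
Variables (R : realType) (H : completeNormedModType R[i]).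
Variable dot : {dot H for Num.conj}.
Hypothesis dot_norm : forall x : H, `|x| ^+ 2 = dot x x.
Variable u : nat -> H.
Hypothesis u_dense : forall (x : H) e, 0 < e -> exists k, sqnorm (x - u k) < e.

Let dot_le1 x : dot x x <= (1 * sqnorm x)%:C.
Proof. by rewrite mul1r (dot_sqnorm dot_norm). Qed.

Let e_ := gram_schmidt dot u.

Lemma bessel_orthonormal : bessel dot e_ 1.
Proof.
move=> n x; have := dot_ge0 dot_norm (residual dot u n x).
rewrite (form_residual (dotP dot) (dotC dot) (dot_ge0 dot_norm)).
rewrite (sum_sqmod (fun k => dot x (e_ k))) (dot_sqnorm dot_norm) mul1r.
by rewrite subr_ge0 lecR.
Qed.

(** The representing vector is [\sum_k conj(phi e_k) e_k] for an orthonormal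
basis [e].  The series converges because testing [phi] on its own partial sums
bounds [\sum |phi e_k|^2] by [M]. *)
Lemma Riesz_representation (phi : H -> R[i]) (M : R) : 0 <= M ->
  (forall a x y, phi (a *: x + y) = a * phi x + phi y) ->
  (forall x, sqmod (phi x) <= M * sqnorm x) ->
  exists z, forall x, phi x = dot x z.
Proof.
move=> M0 phiP phiM.
have phi0 : phi 0 = 0.
  by have := phiP (-1) 0 0; rewrite scaler0 addr0 mulN1r addNr.
have phiD x y : phi (x + y) = phi x + phi y.
  by rewrite -{1}[x]scale1r phiP mul1r.
have phiZ a x : phi (a *: x) = a * phi x.
  by rewrite -[a *: x]addr0 phiP phi0 addr0.
have phiB x y : phi (x - y) = phi x - phi y.
  by rewrite phiD -scaleN1r phiZ mulN1r.
have phi_sum (F : nat -> H) n :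
    phi (\sum_(0 <= k < n) F k) = \sum_(0 <= k < n) phi (F k).
  exact: (big_morph phi).
pose c k := (phi (e_ k))^*%R.
have cM n : \sum_(0 <= k < n) sqmod (c k) <= M.
  set t := \sum_(0 <= k < n) _; pose s := \sum_(0 <= k < n) c k *: e_ k.
  have s_t : sqnorm s <= t.
    have := bessel_synthesis_le dot_norm c 0 n ltr01 bessel_orthonormal.
    by rewrite mul1r.
  have phis : phi s = t%:C.
    rewrite phi_sum /t rmorph_sum; apply: eq_bigr => k _ /=.
    by rewrite phiZ sqmod_conj mulrC mulrJ_sqmod.
  have := phiM s; rewrite phis {1}/sqmod /= expr0n addr0.
  have t0 : 0 <= t by apply: sumr_ge0 => k _; exact: sqmod_ge0.
  have := sqnorm_ge0 s; move: s_t t0 => {phis}; move: (sqnorm s) t => x y.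
  by have [//|?] := leP y M; nra.
have := bessel_series_cvg dot_norm ltr01 bessel_orthonormal cM.
set S := series _ => S_cvg; exists (lim (S n @[n --> \oo])) => x.
apply: (@cvg_complex_unique _ (fun n => dot x (S n))); last first.
  exact: (cvg_dotr dot_norm).
apply/cvgrPdist_lt => e /gt0_complex[r r0 ->].
(* [M] may be 0, hence the shift before dividing. *)
have M1 : 0 < `|M| + 1 by rewrite ltr_wpDl.
have r2 : 0 < r ^+ 2 / (`|M| + 1) by rewrite divr_gt0 // exprn_gt0.
have := form_residual_near0 (dotP dot) (dotC dot) (dot_ge0 dot_norm)
  ltr01 dot_le1 u_dense x r2.
apply: filterS => n; rewrite (dot_sqnorm dot_norm) ltcR ltr_pdivlMr // => lt_r.
have -> : phi x - dot x (S n) = phi (residual dot u n x).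
  rewrite (residualE (dotP dot) (dotC dot) (dot_ge0 dot_norm)).
  rewrite phiB phi_sum dot_sumr.
  by congr (_ - _); apply: eq_bigr => k _; rewrite dotZr phiZ conjCK mulrC.
rewrite -(@ltr_pXn2r _ 2) // ?nnegrE ?normr_ge0 ?ler0c ?(ltW r0) //.
rewrite -sqmodE -rmorphXn ltcR; apply: le_lt_trans lt_r.
apply: le_trans (phiM _) _; rewrite mulrC ler_wpM2l ?sqnorm_ge0 //.
by rewrite (le_trans (ler_norm _)) // lerDl.
Qed.

(** * An independent family with the same energy *)

Section FrameOperator.
Variables (v : nat -> H) (B : R).
Hypotheses (B_gt0 : 0 < B) (v_bessel : bessel dot v B).

Definition frame_sum (n : nat) (x : H) : H :=
  series (fun k => dot x (v k) *: v k) n.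

Definition frame_operator (x : H) : H := lim (frame_sum n x @[n --> \oo]).

Lemma cvg_frame_sum x : frame_sum n x @[n --> \oo] --> frame_operator x.
Proof.
apply: (bessel_series_cvg dot_norm B_gt0 v_bessel) => n; exact: v_bessel.
Qed.

Definition frame_form (x y : H) : R[i] := dot x (frame_operator y).

Lemma frame_formC x y : frame_form x y = (frame_form y x)^*%R.
Proof.
rewrite /frame_form -dotC.
apply: (@cvg_complex_unique _ (fun n => dot x (frame_sum n y))).
  exact: (cvg_dotr dot_norm (@cvg_frame_sum y)).
have -> : (fun n => dot x (frame_sum n y) : R[i]^o) =
    (fun n => dot (frame_sum n x) y).
  apply/funext => n; rewrite dot_sumr dot_suml; apply: eq_bigr => k _.
  by rewrite dotZl dotZr [dot (v k) y]dotC mulrC.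
exact: (cvg_dotl dot_norm (@cvg_frame_sum x)).
Qed.

Lemma frame_formE x : exists l : R, [/\ frame_form x x = l%:C,
  0 <= l, l <= B * sqnorm x &
  \sum_(0 <= k < n) sqmod (dot x (v k)) @[n --> \oo] --> l].
Proof.
pose r n := \sum_(0 <= k < n) sqmod (dot x (v k)).
have r_cvg : cvgn r.
  apply: nondecreasing_is_cvgn.
    by apply: nondecreasing_series => k _ _; exact: sqmod_ge0.
  by exists (B * sqnorm x) => _ [n _ <-]; exact: v_bessel.
exists (limn r); split => //.
- apply: (@cvg_complex_unique _ (fun n => dot x (frame_sum n x))).
    exact: (cvg_dotr dot_norm (@cvg_frame_sum x)).
  have -> : (fun n => dot x (frame_sum n x) : R[i]^o) = (fun n => (r n)%:C).
    apply/funext => n; rewrite dot_sumr rmorph_sum; apply: eq_bigr => k _ /=.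
    by rewrite dotZr mulrC mulrJ_sqmod.
  exact: cvg_real_complex.
- apply: limr_ge => //; apply: nearW => n.
  by apply: sumr_ge0 => k _; exact: sqmod_ge0.
- by apply: limr_le => //; apply: nearW => n; exact: v_bessel.
Qed.

(** The vectors are [w_k = P h_k], where [P] is the frame operator of [v] and [h]
the Gram-Schmidt sequence of the dense sequence for the form [<x, P y>].  The
biorthogonality relation covers the indices [k] with [w_k = 0] as well, since
then [j <> k]. *)
Lemma biorthogonal_tight_family : exists w h : nat -> H,
  (forall x, (\sum_(k <oo) (sqmod (dot x (w k)))%:E =
              \sum_(k <oo) (sqmod (dot x (v k)))%:E)%E) /\
  (forall j k, w j != 0 -> dot (h j) (w k) = (j == k)%:R).
Proof.
pose q := frame_form.
have qP a x y z : q (a *: x + y) z = a * q x z + q y z by exact: dotP.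
have qC : forall x y, q x y = (q y x)^*%R by exact: frame_formC.
have q_ge0 x : 0 <= q x x.
  by have [l [ql l0 _ _]] := frame_formE x; rewrite /q ql ler0c.
have q_le x : q x x <= (B * sqnorm x)%:C.
  by have [l [ql _ l1 _]] := frame_formE x; rewrite /q ql lecR.
pose h := gram_schmidt q u; exists (fun k => frame_operator (h k)), h; split.
  move=> x; have [l [ql _ _ lcvg]] := frame_formE x.
  have := @cvg_sum_form_gram_schmidt _ _ q B qP qC q_ge0 B_gt0 q_le u u_dense x.
  rewrite -/h {2}/q ql /= => wcvg.
  have limE (f : nat -> R) : \sum_(0 <= k < n) f k @[n --> \oo] --> l ->
      (\sum_(k <oo) (f k)%:E = l%:E)%E.
    move=> fl; apply: cvg_lim => //.
    under eq_fun do rewrite sumEFin.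
    by apply: cvg_EFin => //; apply: nearW.
  by rewrite (limE _ wcvg) (limE _ lcvg).
move=> j k wj; rewrite -/(frame_form (h j) (h k)) -/q.
have [<-|njk] := eqVneq j k; last first.
  exact: (gram_schmidt_orth qP qC q_ge0 u njk).
have [hj|//] := gram_schmidt_unit qP qC q_ge0 u j.
(* [h j = 0] would give [w j = P 0], and [|P 0|^2 = q (P 0) 0 = 0]. *)
case/eqP: wj; apply/eqP; rewrite -/h in hj; rewrite hj -sqnorm_eq0.
rewrite -(inj_eq (@complexI R)) -(dot_sqnorm dot_norm).
by apply/eqP; exact: (form_anti0 qP qC (frame_operator 0)).
Qed.

End FrameOperator.
End Hilbert.

(** * From sequences to families *)

Lemma card_le_setT_inj (T U : Type) :
  ([set: T] #<= [set: U])%card -> exists f : T -> U, injective f.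
Proof.
move=> /card_leP[f].
exists (fun x => set_val (f (SigSub (mem_set (I : [set: T] x))))).
move=> x y /val_inj /inj; move=> /(_ (mem_set _) (mem_set _)) fxy.
by have [] := fxy I I.
Qed.

Lemma extend_by (I T X : Type) (x0 : X) (e : I -> T) (v : I -> X) :
  injective e -> exists v' : T -> X,
    (forall i, v' (e i) = v i) /\ (forall t, (forall i, e i <> t) -> v' t = x0).
Proof.
move=> e_inj.
have /choice[v' v'P] (t : T) : exists x,
    (forall i, e i = t -> x = v i) /\ ((forall i, e i <> t) -> x = x0).
  have [[i <-]|nt] := pselect (exists i, e i = t).
    by exists (v i); split=> [j /e_inj->//|/(_ i)].
  by exists x0; split=> // i eit; case: nt; exists i.
exists v'; split=> [i|t]; first by have [/(_ i erefl)] := v'P (e i).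
by have [_] := v'P t.
Qed.

Lemma esum_nneseries_extend (R : realType) (I : choiceType) (e : I -> nat)
    (X : Type) (x0 : X) (v : I -> X) (v' : nat -> X) (f : X -> \bar R) :
  injective e -> (forall i, v' (e i) = v i) ->
  (forall t, (forall i, e i <> t) -> v' t = x0) ->
  (forall x, 0 <= f x)%E -> f x0 = 0%E ->
  (\esum_(i in [set: I]) f (v i) = \sum_(k <oo) f (v' k))%E.
Proof.
move=> e_inj v'e v'0 f0 fx0; rewrite nneseries_esumT //.
under eq_esum do rewrite -v'e.
rewrite -(esum_image [set: I] e (fun k => f (v' k))); last first.
  by move=> i j _ _ /e_inj.
rewrite esum_mkcond; apply: eq_esum => k _.
case: ifPn => // /negP nk; rewrite v'0 // => i eik.
by apply: nk; rewrite inE; exists i.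
Qed.

Section Families.
Variables (R : realType) (H : completeNormedModType R[i]).
Variable dot : {dot H for Num.conj}.
Hypothesis dot_norm : forall x : H, `|x| ^+ 2 = dot x x.
Hypothesis H_separable : separable_space H.

Lemma separable_dense_seq : exists u : nat -> H,
  forall (x : H) (e : R), 0 < e -> exists k, sqnorm (x - u k) < e.
Proof.
have [D countD denseD] := H_separable.
have [f Df] : exists f : nat -> H, D `<=` range f.
  move/pfcard_geP: countD => [->|[f]]; first by exists (fun=> 0).
  exists f => x Dx; have [n _ <-] := 'surj_f Dx; by exists n.
exists f => x e e0; pose r := Num.sqrt e.
have r0 : 0 < r by rewrite sqrtr_gt0.
have : (ball x r%:C `&` D) !=set0.
  apply: denseD; last exact: ball_open.
  by exists x; apply: ballxx; rewrite ltcR.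
move=> [y [xy /Df[k _ fk]]]; exists k; rewrite fk.
by move: xy; rewrite -ball_normE /= norm_lt_sqnorm // sqr_sqrtr ?ltW.
Qed.

(** The quadratic form [<P y, y>] of the frame operator [P] of [v]. *)
Definition energy (I : choiceType) (v : I -> H) (y : H) : \bar R :=
  \esum_(i in [set: I]) (sqmod (dot y (v i)))%:E.

(** [biorthogonal_tight_family] for families: [v] is turned into a sequence by
padding with zeros, which have no energy, and the indices of the zero terms of
the resulting sequence are discarded. *)
Lemma biorthogonal_family (I : countType) (v : I -> H) (B : R) : 0 < B ->
  (forall y, energy v y <= (B * sqnorm y)%:E)%E ->
  exists (J : countType) (w h : J -> H),
    [/\ forall j, w j != 0, energy w = energy v
      & forall j k, dot (h j) (w k) = (j == k)%:R].
Proof.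
move=> B0 vB.
have pickle_inj : injective (@pickle I) by exact: pcan_inj (@pickleK I).
have [v' [v'e v'0]] := extend_by 0 v pickle_inj.
have energyE y : energy v y = (\sum_(k <oo) (sqmod (dot y (v' k)))%:E)%E.
  apply: (esum_nneseries_extend (f := fun x => (sqmod (dot y x))%:E)
    pickle_inj v'e v'0).
    by move=> x; rewrite lee_fin sqmod_ge0.
  by rewrite dot0r sqmod0.
have v'B : bessel dot v' B.
  move=> n x; rewrite -lee_fin; apply: le_trans (vB x).
  rewrite energyE -sumEFin.
  by apply: nneseries_lim_ge => k _ _; rewrite lee_fin sqmod_ge0.
have [u u_dense] := separable_dense_seq.
have [w [h [wE hw]]] := biorthogonal_tight_family dot_norm u_dense B0 v'B.
exists {k : nat | w k != 0}, (fun k => w (val k)), (fun k => h (val k)); split.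
- by move=> [k].
- apply/funext => y; rewrite energyE -wE.
  apply: (esum_nneseries_extend (f := fun x => (sqmod (dot y x))%:E)
    (e := val) (x0 := 0)) => //.
  + move=> t nt; apply/eqP; apply: contraT => wt.
    by case: (nt (exist _ t wt)).
  + by move=> x; rewrite lee_fin sqmod_ge0.
  + by rewrite dot0r sqmod0.
- by move=> [j wj] [k wk]; rewrite hw.
Qed.

Lemma biorthogonal_lin_independent (J : choiceType) (w h : J -> H) :
  (forall j k, dot (h j) (w k) = (j == k)%:R) -> lin_independent w.
Proof.
move=> hw s c s_uniq cw0 k ks.
have := congr1 (dot (h k)) cw0; rewrite dot0r dot_sumr (bigD1_seq k) //=.
rewrite big1 => [|j /negPf jk]; last by rewrite dotZr hw eq_sym jk mulr0.
by rewrite addr0 dotZr hw eqxx mulr1 => /eqP; rewrite fmorph_eq0 => /eqP.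
Qed.

Lemma energy_eq0 (I : choiceType) (v : I -> H) y :
  energy v y = 0%E <-> forall i, dot y (v i) = 0.
Proof.
split=> [v0 i|v0]; last by apply: esum1 => i _; rewrite v0 sqmod0.
apply/eqP; rewrite -sqmod_eq0 eq_le sqmod_ge0 andbT -lee_fin.
rewrite -[leRHS]/(0%E) -v0.
apply: esum_ge; exists [set i]; first by split; [exact: finite_set1|].
by rewrite fsbig_set1.
Qed.

(** The matrix [M] of the [<h_j, v_i>] is square once [n] indices [j] are selected
and [v] is padded with zeros.  It is invertible because a left kernel vector
yields a combination of the [h_j] of energy 0, whose products with the [w_j]
are its coefficients; a linear relation between the [v_i] is, after
conjugation, a right kernel vector. *)
Lemma biorthogonal_card_lin_independent (I J : choiceType) (v : I -> H)
    (w h : J -> H) n :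
  ([set: I] #<= `I_n)%card -> (`I_n #<= [set: J])%card ->
  energy w = energy v ->
  (forall j k, dot (h j) (w k) = (j == k)%:R) -> lin_independent v.
Proof.
rewrite (card_le_eqr card_II) => /card_le_setT_inj[g g_inj].
rewrite (card_le_eql card_II) => /card_le_setT_inj[f f_inj] energyE hw.
have [v' [v'g v'0]] := extend_by 0 v g_inj.
pose M := \matrix_(a < n, b < n) dot (h (f a)) (v' b).
have M_unit : M \in unitmx.
  rewrite -row_free_unit; apply: inj_row_free => c cM; apply/rowP => b.
  pose x := \sum_(a < n) c 0 a *: h (f a).
  have /energy_eq0 : forall i, dot x (v i) = 0.
    move=> i; have /rowP/(_ (g i)) := cM; rewrite !mxE => <-.
    by rewrite dot_suml; apply: eq_bigr => a _; rewrite mxE v'g dotZl.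
  rewrite -energyE => /energy_eq0/(_ (f b)); rewrite mxE => <-.
  rewrite dot_suml (bigD1 b) //= big1 => [|a /negPf ab].
    by rewrite dotZl hw eqxx mulr1 addr0.
  by rewrite dotZl hw (inj_eq f_inj) ab mulr0.
move=> s c s_uniq cv0 k ks.
have [c' [c'g c'0]] := extend_by 0 (fun i => if i \in s then c i else 0) g_inj.
suff /colP/(_ (g k)) : \col_b (c' b)^*%R = 0 :> 'cV_n.
  by rewrite !mxE c'g ks => /eqP; rewrite fmorph_eq0 => /eqP.
apply: (can_inj (mulKmx M_unit)); rewrite mulmx0; apply/colP => a; rewrite !mxE.
transitivity (dot (h (f a)) (\sum_b c' b *: v' b)).
  by rewrite dot_sumr; apply: eq_bigr => b _; rewrite !mxE dotZr mulrC.
rewrite (bigID (mem (map g s))) /= [X in _ + X]big1 ?addr0; last first.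
  move=> b nb; have [[i gi]|ni] := pselect (exists i, g i = b).
    rewrite -gi c'g; case: ifPn => // i_s; last by rewrite scale0r.
    by move: nb; rewrite -gi map_f.
  by rewrite c'0 ?scale0r // => i gi; apply: ni; exists i.
rewrite -big_uniq ?map_inj_uniq // big_map.
rewrite -[X in dot _ X]/(\sum_(i <- s) c' (g i) *: v' (g i)).
under eq_big_seq => i i_s do rewrite c'g v'g i_s.
by rewrite cv0 dot0r.
Qed.

End Families.

(** * Orbits and indices *)

Section Orbits.
Variables (R : realType) (H : completeNormedModType R[i]).
Variable dot : {dot H for Num.conj}.
Hypothesis dot_norm : forall x : H, `|x| ^+ 2 = dot x x.
Hypothesis H_separable : separable_space H.
Variable T : {linear H -> H}.
Hypothesis T_bounded : bounded_operator T.

Lemma adjoint_exists : exists Tadj : H -> H,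
  forall x y, dot (T x) y = dot x (Tadj y).
Proof.
have [u u_dense] := separable_dense_seq H_separable.
suff /choice[Tadj TadjP] : forall y, exists z, forall x, dot (T x) y = dot x z.
  by exists Tadj => x y; rewrite TadjP.
move=> y; have [M TM] := T_bounded.
apply: (Riesz_representation dot_norm u_dense (M := M ^+ 2 * sqnorm y)).
- by rewrite mulr_ge0 ?sqr_ge0 ?sqnorm_ge0.
- by move=> a x x'; rewrite linearP dotP.
- move=> x; apply: le_trans (dot_CauchySchwarz dot_norm _ _) _.
  rewrite mulrAC ler_wpM2r ?sqnorm_ge0 //.
  rewrite -lecR rmorphM rmorphXn /= !sqnormE -exprMn.
  by rewrite lerXn2r ?nnegrE // (le_trans _ (TM x)).
Qed.

Definition orbit_energy (I : countType) (v : I -> H) (y : H) : \bar R :=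
  \esum_(k in [set: I * nat]) (sqnorm (dot y (orbit_family T v k) : R[i]^o))%:E.

(** Moving [T^n] to the other side of the inner product shows that frame sums of
orbits depend on [v] through its energy only. *)
Lemma orbit_energyE (Tadj : H -> H) (I : countType) (v : I -> H) y :
  (forall x y, dot (T x) y = dot x (Tadj y)) ->
  orbit_energy v y =
  (\esum_(n in [set: nat]) energy dot v (iter n Tadj y))%E.
Proof.
move=> TadjP.
have iterP n : forall x y, dot y (iter n T x) = dot (iter n Tadj y) x.
  elim: n => [//|n IHn] x z.
  by rewrite iterSr IHn -/(iter _ _ _) /= [RHS]dotC -TadjP -dotC.
rewrite /energy esum_esum => [|n i _ _]; last by rewrite lee_fin sqmod_ge0.
rewrite /orbit_energy.
rewrite (reindex_esum ([set: nat] `*`` (fun=> [set: I])) [set: I * nat]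
  (fun k => (k.2, k.1))).
  by apply: eq_esum => -[n i] _ /=; rewrite sqmod_sqnorm /orbit_family /= iterP.
by split=> [//|[n i] [m j] _ _ [-> ->]//|[i n] _]; exists (n, i).
Qed.

(** The terms [n = 0] of the orbits: this is why generators form a Bessel
family. *)
Lemma energy_le_orbit_energy (I : countType) (v : I -> H) y :
  (energy dot v y <= orbit_energy v y)%E.
Proof.
have [Tadj TadjP] := adjoint_exists.
rewrite (orbit_energyE _ _ TadjP); apply: esum_ge; exists [set 0%N].
  by split; [exact: finite_set1|].
by rewrite fsbig_set1.
Qed.

(** Frames and Parseval frames of orbits are treated at once: [F] is any condition
on the function [orbit_energy v] that includes an upper frame bound. *)
Section Index.
Variable F : (H -> \bar R) -> Prop.
Hypothesis F_bessel : forall E, F E ->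
  exists2 B : R, 0 < B & forall y, (E y <= (B * sqnorm y)%:E)%E.

Let G (I : countType) (v : I -> H) : Prop :=
  (forall k, v k != 0) /\ F (orbit_energy v).

Let index := generator_index G.

Lemma biorthogonal_generators (I : countType) (v : I -> H) : G v ->
  exists (J : countType) (w h : J -> H),
    [/\ G w, energy dot w = energy dot v
      & forall j k, dot (h j) (w k) = (j == k)%:R].
Proof.
move=> [v0 Fv]; have [B B0 vB] := F_bessel Fv.
have [|J [w [h [w0 wE hw]]]] :=
    biorthogonal_family dot_norm H_separable B0 (v := v).
  by move=> y; apply: le_trans (vB y); exact: energy_le_orbit_energy.
exists J, w, h; split=> //; split=> //.
have [Tadj TadjP] := adjoint_exists.
suff -> : orbit_energy w = orbit_energy v by [].
by apply/funext => y; rewrite !(orbit_energyE _ _ TadjP) wE.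
Qed.

(** By minimality the independent generators [w] with the same energy as [v] are
at least [n] in number, so [biorthogonal_card_lin_independent] applies. *)
Lemma minimal_generators_lin_independent n (I : countType) (v : I -> H) :
  (forall m (J : countType) (w : J -> H),
     ([set: J] #= `I_m)%card -> G w -> (n <= m)%N) ->
  ([set: I] #= `I_n)%card -> G v -> lin_independent v.
Proof.
move=> n_min In Gv; have [J [w [h [Gw wE hw]]]] := biorthogonal_generators Gv.
apply: (biorthogonal_card_lin_independent (n := n) _ _ wE hw).
  by case/card_eqPle: In.
have [[m Jm]|/infiniteP] := pselect (finite_set [set: J]).
  case/card_eqPle: (Jm) => _; apply: card_le_trans.
  by rewrite card_le_II; exact: n_min Jm Gw.
by apply: card_le_trans; exact: card_leT.
Qed.

Lemma lin_independent_generators_of_index :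
  ((0 < index)%E -> exists (I : countType) (v : I -> H),
     [/\ G v, has_cardinality I index & lin_independent v]) /\
  ((0 < index)%E -> (index < +oo)%E ->
     forall (I : countType) (v : I -> H),
       G v -> has_cardinality I index -> lin_independent v).
Proof.
rewrite /index /generator_index; case: pselect => [ex_fin|no_fin].
  case: ex_minnP => n /asboolP[I [v [In Gv]]] n_min.
  have lin (J : countType) (w : J -> H) :
      G w -> has_cardinality J n%:Z%:E -> lin_independent w.
    move=> Gw Jn; apply: (minimal_generators_lin_independent _ Jn Gw).
    by move=> m K x Km Gx; apply: n_min; apply/asboolP; exists K, x.
  by split=> [_|_ _]; [exists I, v; split=> //; exact: lin|exact: lin].
case: asboolP => [[I [v Gv]]|_]; last by split; rewrite ltxx.
split=> [_|_]; last by rewrite ltxx.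
have [J [w [h [Gw _ hw]]]] := biorthogonal_generators Gv.
exists J, w; split=> //; last exact: biorthogonal_lin_independent hw.
apply: eq_card_nat; first exact: countableP.
by move=> [m Jm]; apply: no_fin; exists m; apply/asboolP; exists J, w.
Qed.

End Index.
End Orbits.

Theorem corollary4p7 (R : realType) (H : completeNormedModType R[i])
    (dot : {dot H for Num.conj})
    (dot_norm : forall x : H, `|x| ^+ 2 = dot x x)
    (H_separable : separable_space H)
    (H_infinite_dimensional : infinite_dimensional H)
    (T : {linear H -> H}) (T_bounded : bounded_operator T) :
  let gamma := frame_index dot T in
  let gamma_p := parseval_frame_index dot T in
  (((0 < gamma)%E ->
     exists (I : countType) (v : I -> H),
       [/\ generators dot T v, has_cardinality I gamma & lin_independent v])
   /\ ((0 < gamma)%E -> (gamma < +oo)%E ->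
     forall (I : countType) (v : I -> H),
       generators dot T v -> has_cardinality I gamma -> lin_independent v))
  /\
  (((0 < gamma_p)%E ->
     exists (I : countType) (v : I -> H),
       [/\ parseval_generators dot T v, has_cardinality I gamma_p
         & lin_independent v])
   /\ ((0 < gamma_p)%E -> (gamma_p < +oo)%E ->
     forall (I : countType) (v : I -> H),
       parseval_generators dot T v -> has_cardinality I gamma_p ->
       lin_independent v)).
Proof.
pose bounds A B (E : H -> \bar R) :=
  forall y, ((A * sqnorm y)%:E <= E y <= (B * sqnorm y)%:E)%E.
split.
- apply: (lin_independent_generators_of_index dot_norm H_separable T_bounded
    (F := fun E => exists A B : R, [/\ 0 < A, 0 < B & bounds A B E])).
  by move=> E [A [B [_ B0 EB]]]; exists B => // y; case/andP: (EB y).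
- apply: (lin_independent_generators_of_index dot_norm H_separable T_bounded
    (F := bounds 1 1)).
  by move=> E E1; exists 1 => // y; case/andP: (E1 y).
Qed.
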